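(* Let $R\in\mathbb{N}^*$. Suppose that for every $r\in\{1,\dots,R\}$, $U^{rn}\to U^r$ in probability and $\theta^n_0\to\theta_0$ in probability as $n\to+\infty$, and that assumptions (H-R), (HUI), (HC1), (HC2), (HRG), (HS) and (HUA) of the context hold. Suppose that the step sequence is given by $\gamma(p)=\gamma_0/p^{\beta}$, $p>0$, with $\gamma_0>0$ and $\beta\in(1/2,1]$. Then the multi-step Richardson-Romberg stochastic approximation estimator of order $R$ satisfies, as $\varepsilon\to0$, $$\inf_{(n,M)\in A_\varepsilon}\mathrm{Cost}(n,M)\ \sim\ K\frac{R(R+1)}{2}\gamma_0^{\frac1\beta}\nu_R^{\frac2\beta}\mu_R^{\frac{1}{\alpha R}}\frac{1}{\varepsilon^{\frac2\beta+\frac1{\alpha R}}}\left(1+\frac{2\alpha R}{\beta}\right)^{\frac1{\alpha R}}\left(1+\frac{\beta}{2\alpha R}\right)^{\frac2\beta},$$ where $$A_\varepsilon=\left\{(n,M)\in(\mathbb{N}^* )^2:\ \mu_Rn^{-\alpha R}\left(1+|\epsilon_{R+1}(n)|\right)+\nu_R\gamma^{1/2}(M)\left(1+\phi^R_1(n)+\phi^R_2(M)\right)\le\varepsilon\right\}.$$ Moreover, this asymptotically optimal bound may be achieved with parameters satisfying, as $\varepsilon\to0$, $$n(\varepsilon)\sim\left(\frac{2\alpha R}{\beta}+1\right)^{\frac1{\alpha R}}\mu_R^{\frac1{\alpha R}}\varepsilon^{-\frac1{\alpha R}},\qquad M(\varepsilon)\sim\gamma_0^{\frac1\beta}\nu_R^{\frac2\beta}\left(1+\frac{\beta}{2\alpha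 R}\right)^{\frac2\beta}\varepsilon^{-\frac2\beta}.$$
   Context: Setting. $\alpha>0$ is fixed, $H:\mathbb{R}^d\times\mathbb{R}^q\to\mathbb{R}^d$, $U$ and $U^n$ ($n\in\mathbb{N}^*$) are $\mathbb{R}^q$-valued random vectors, $h(\theta):=\mathbb{E}[H(\theta,U)]$, $h^n(\theta):=\mathbb{E}[H(\theta,U^n)]$; $\theta^*$ is the zero of $h$ and $\theta^{*,n}$ the zero of $h^n$. For each $n$, $(U^{rn})_{1\le r\le R}$ is a family of random vectors where $U^{rn}$ has the law of the approximation $U^m$ with $m=rn$; $U^1,\dots,U^R$ denote the limits (in probability) of $U^n,\dots,U^{Rn}$, each $U^r$ having the law of $U$; all variables are defined on the same probability space. Weights. For $r\in\{1,\dots,R\}$, $\mathbf{w}_r=(-1)^{R-r}\frac{r^{\alpha R}}{\prod_{j=0}^{r-1}(r^{\alpha}-j^{\alpha})\prod_{j=r+1}^R(j^{\alpha}-r^{\alpha})}I_d$ (empty products equal $1$; $I_d$ is the $d\times d$ identity matrix). Schemes. For $r\in\{1,\dots,R\}$, $\theta^{rn}_{p+1}=\theta^{rn}_p-\gamma_{p+1}H(\theta^{rn}_p,(U^{rn})^{p+1})$, $p\in\{0,\dots,M-1\}$, where $((U^{rn})^p,\ r=1,\dots,R)_{1\le p\le M}$ is i.i.d. with the law of $(U^{rn},\ r=1,\dots,R)$; the initial conditions $\theta^{rn}_0$ (taken from a sequence $(\theta^n_0)_{n\ge1}$) are independent of the innovations with $\sup_{n\ge1}\mathbb{E}|\theta^n_0|^2<+\infty$;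 the deterministic decreasing non-negative steps $\gamma_p=\gamma(p)$ satisfy $\sum_p\gamma_p=+\infty$, $\sum_p\gamma_p^2<+\infty$. The multi-step Richardson-Romberg estimator of order $R$ is $\sum_{r=1}^R\mathbf{w}_r\theta^{rn}_M$ and its statistical error is $\mathcal{E}^{R-R}_S(n,M):=\sum_{r=1}^R\mathbf{w}_r(\theta^{*,rn}-\theta^{rn}_M)$. Simulating one copy of $U^n$ costs $Kn$ for a constant $K>0$, so the estimator has cost $\mathrm{Cost}(n,M):=KMn\frac{R(R+1)}{2}$. Assumptions. - (H-R): (1) for all $\theta\in\mathbb{R}^d$, $h(\theta)-h^n(\theta)=\sum_{j=1}^R\Lambda^0_j(\theta)n^{-\alpha j}+o(n^{-\alpha R})$; (2) $h,h^n\in\mathcal{C}^R(\mathbb{R}^d,\mathbb{R}^d)$ and for all $1\le l\le R-1$ and all $\theta$, $D^lh^n(\theta)-D^lh(\theta)=\sum_{j=1}^{R-l}\Lambda^l_j(\theta)n^{-\alpha j}+o(n^{-\alpha(R-l)})$, where the $\Lambda^l_j(\theta)$ and the remainder are multilinear maps from $(\mathbb{R}^d)^l$ to $\mathbb{R}^d$; (3) for all $l\in\{1,\dots,R\}$, $(D^lh^n)_{n\ge1}$ converges locally uniformly to $D^lh$; (4) $Dh(\theta^* )$ is invertible. - (HUI): there is $\delta>0$ such that for all $\theta\in\mathbb{R}^d$, $\sup_{n\in\mathbb{N}^*}\mathbb{E}[|H(\theta,U^n)|^{2+\delta}]<+\infty$. - (HC1): there is $C>0$ such that for all $n\in\mathbb{N}^*$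 and $\theta\in\mathbb{R}^d$, $\mathbb{E}[|H(\theta,U^n)|^2]\le C(1+|\theta-\theta^{*,n}|^2)$. - (HC2): for all $\theta\in\mathbb{R}^d$, $\mathbb{P}(U\notin\mathcal{C}_\theta)=0$, where $\mathcal{C}_\theta:=\{x\in\mathbb{R}^q:\ H(\theta,\cdot)\text{ is continuous at }x\}$. - (HRG): there is $a\in(0,1]$ such that $\sup_{n\in\mathbb{N}^*,\,\theta\neq\theta'}\mathbb{E}|H(\theta,U^n)-H(\theta',U^n)|^2/|\theta-\theta'|^{2a}<+\infty$. - (HUA): for each $n\in\mathbb{N}^*$, $h^n$ is continuously differentiable on $\mathbb{R}^d$, with $Dh^n$ Lipschitz-continuous uniformly in $n$, and there exists $\underline{\lambda}>0$ such that $\inf_{n\in\mathbb{N}^*,\theta\in\mathbb{R}^d}\lambda_{\min}\big((Dh^n(\theta)+Dh^n(\theta)^T)/2\big)>\underline{\lambda}$, where $\lambda_{\min}(A)$ is the lowest eigenvalue of $A$. - (HS): $\gamma_p=\gamma(p)$, $p\ge1$, where $\gamma$ is a positive function on $[0,+\infty)$ decreasing to zero and satisfying one of: (i) $\gamma$ varies regularly with exponent $-\rho$, $\rho\in(1/2,1)$, i.e. $\lim_{t\to+\infty}\gamma(tx)/\gamma(t)=x^{-\rho}$ for every $x>0$; (ii) $\gamma(t)=\gamma_0/t$ for $t\ge1$, with $2\underline{\lambda}\gamma_0>1$. (In particular, when $\beta=1$ the constraint $2\underline{\lambda}\gamma_0>1$ is in force.) Quantities in the constraint. Under (H-R) there are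 vectors $C_1,\dots,C_R\in\mathbb{R}^d$ for which one writes, for $r\in\{1,\dots,R\}$, $\theta^{*,rn}=\theta^*+\sum_{p=1}^{R-1}\frac{C_p}{r^{\alpha p}}\frac1{n^{\alpha p}}+\frac{C_R}{r^{\alpha R}}\frac1{n^{\alpha R}}(1+\epsilon_r(n))$ with $\epsilon_r(n)\to0$ as $n\to+\infty$. One sets $\widetilde{\mathbf{w}}_{R+1}=(-1)^{R-1}/(R!)^{\alpha}$ and $$\epsilon_{R+1}(n)=\frac{1}{\widetilde{\mathbf{w}}_{R+1}}\sum_{r=1}^R\frac{(-1)^{R-r}}{\prod_{j=0}^{r-1}(r^\alpha-j^\alpha)\prod_{j=r+1}^R(j^\alpha-r^\alpha)}\epsilon_r(n)\longrightarrow0,$$ so that $\sum_{r=1}^R\mathbf{w}_r\theta^{*,rn}=\theta^*+C_Rn^{-\alpha R}\widetilde{\mathbf{w}}_{R+1}(1+\epsilon_{R+1}(n))$. Set $\mu_R=|C_R|/(R!)^{\alpha}$ and $\nu_R=C\,\mathbb{E}\big[|\sum_{r=1}^R\mathbf{w}_rH(\theta^*,U^r)|^2\big]^{1/2}$. Here $C=C(\gamma,\underline{\lambda})>0$ is a constant and $\phi^R_1,\phi^R_2$ are positive functions, with $\phi^R_1(n)\to0$ as $n\to+\infty$, $\phi^R_2(M)\to0$ as $M\to+\infty$ and $\phi^R_2$ non-increasing, such that $\mathbb{E}[|\mathcal{E}^{R-R}_S(n,M)|]\le\nu_R\,\gamma^{1/2}(M)(1+\phi^R_1(n)+\phi^R_2(M))$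 for all $n,M\in\mathbb{N}^*$ (such a bound holds whenever $U^{rn}\to U^r$ in probability for every $r\in\{1,\dots,R\}$ and $\theta^n_0\to\theta_0$ in probability as $n\to+\infty$, and (H-R), (HUI), (HC1), (HC2), (HRG), (HS) and (HUA) hold). The notation $f(\varepsilon)\sim g(\varepsilon)$ means $f(\varepsilon)/g(\varepsilon)\to1$.
   Formalization: The formal statement additionally assumes μ_R > 0 and ν_R > 0 (that is, C_R ≠ 0 and a non-vanishing noise term), since otherwise the claimed equivalent is identically 0 and f/g → 1 has no meaning. *)

(* Defs.v *)
From HB Require Import structures.
From mathcomp Require Import all_boot all_order all_algebra.
From mathcomp Require Import all_classical all_reals all_analysis.

Set Implicit Arguments.
Unset Strict Implicit.
Unset Printing Implicit Defensive.

Import Order.TTheory GRing.Theory Num.Theory.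
Import numFieldTopology.Exports numFieldNormedType.Exports.

Local Open Scope classical_set_scope.
Local Open Scope ring_scope.

(* Points of R^d are row vectors.  The norm that the library puts on matrices
   is the max norm; it is used below only through the topology it induces,
   and |.| is always the Euclidean norm. *)
Definition enorm {R : realType} {d : nat} (x : 'rV[R]_d) : R :=
  Num.sqrt (\sum_(i < d) x ord0 i ^+ 2).

Definition opnorm {R : realType} {d : nat} (A : 'M[R]_d) : R :=
  sup [set enorm (x *m A) | x in [set x : 'rV[R]_d | enorm x <= 1]].

(* For a real symmetric matrix this is its lowest eigenvalue. *)
Definition lambda_min {R : realType} {d : nat} (A : 'M[R]_d) : R :=
  inf [set a : R | eigenvalue A a].

Section Differential.
Context {R : realType} {d : nat}.
Local Notation V := ('rV[R]_d).

(* In finite dimension Df is C^k iff x |-> Df(x)v is C^k for every v. *)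
Fixpoint class_C (k : nat) (f : V -> V) : Prop :=
  if k is k'.+1 then
    (forall x, differentiable f x) /\ forall v, class_C k' (fun x => 'd f x v)
  else continuous f.

Fixpoint iter_diff (vs : seq V) (f : V -> V) : V -> V :=
  if vs is v :: vs' then iter_diff vs' (fun x => 'd f x v) else f.

(* D^l f(x)(v_1, ..., v_l); the order in which the directions are taken is
   irrelevant for f of class C^l. *)
Definition Dn (l : nat) (f : V -> V) (x : V) (v : l.-tuple V) : V :=
  iter_diff v f x.

Definition multilinear (l : nat) (A : l.-tuple V -> V) : Prop :=
  forall (i : 'I_l) (v : l.-tuple V) (a : R) (x y : V),
    let subst z := [tuple if j == i then z else tnth v j | j < l] in
    A (subst (a *: x + y)) = a *: A (subst x) + A (subst y).

(* The operator norm of A is at most b. *)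
Definition mnorm_le (l : nat) (A : l.-tuple V -> V) (b : R) : Prop :=
  forall v : l.-tuple V, (forall i, enorm (tnth v i) <= 1) -> enorm (A v) <= b.

End Differential.

Section Probability.
Context {R : realType} {disp : measure_display} {Omega : measurableType disp}.
Variable P : probability Omega R.

Definition borel (T : topologicalType) : set (set T) := <<s @open T >>.

Definition borel_fun {S T : topologicalType} (f : S -> T) : Prop :=
  forall B, borel B -> borel (f @^-1` B).

Definition random_element {T : topologicalType} (X : Omega -> T) : Prop :=
  forall B, borel B -> measurable (X @^-1` B).

Definition same_law {T : topologicalType} (X Y : Omega -> T) : Prop :=
  forall B, borel B -> P (X @^-1` B) = P (Y @^-1` B).

Definition sigma_of {T : topologicalType} (X : Omega -> T) :
  set (set Omega) := preimage_set_system setT X (@borel T).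

Definition mutually_independent {I : eqType} (F : I -> set (set Omega)) :
    Prop :=
  forall (J : seq I) (A : I -> set Omega),
    uniq J -> (forall i, i \in J -> F i (A i)) ->
    (P (\bigcap_(i in [set` J]) A i) = \prod_(i <- J) P (A i))%E.

Definition cvg_in_proba {m : nat} (X : nat -> Omega -> 'rV[R]_m)
    (Y : Omega -> 'rV[R]_m) : Prop :=
  forall eta : R, 0 < eta ->
    P [set w | eta < enorm (X n w - Y w)] @[n --> \oo] --> 0%E.

(* (X_1, ..., X_N) as a random element of R^(N x m); row i holds X_(i+1). *)
Definition pack (N : nat) {m : nat} (X : nat -> Omega -> 'rV[R]_m)
    (w : Omega) : 'M[R]_(N, m) :=
  \matrix_(i < N, j < m) X i.+1 w ord0 j.

(* Meaningful where H(theta, U) is integrable, as for U^n under (HUI). *)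
Definition mean_field {d q : nat} (H : 'rV[R]_d -> 'rV[R]_q -> 'rV[R]_d)
    (U : Omega -> 'rV[R]_q) (theta : 'rV[R]_d) : 'rV[R]_d :=
  \row_(j < d) fine 'E_P[fun w => H theta (U w) ord0 j]%E.

(* V p is the p-th innovation, p >= 1; V 0 is unused. *)
Fixpoint sa_scheme {d q : nat} (H : 'rV[R]_d -> 'rV[R]_q -> 'rV[R]_d)
    (gamma : R -> R) (theta0 : Omega -> 'rV[R]_d)
    (V : nat -> Omega -> 'rV[R]_q) (p : nat) (w : Omega) : 'rV[R]_d :=
  if p is p'.+1 then
    let theta := sa_scheme H gamma theta0 V p' w in
    theta - gamma p'.+1%:R *: H theta (V p'.+1 w)
  else theta0 w.

(* For each n >= 1, the innovations innov n p = ((U^(rn))^p)_(1 <= r <= N),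
   p >= 1, are i.i.d. with the law of (U^(rn))_(1 <= r <= N) and independent of
   the initial conditions (theta_0^(rn))_(1 <= r <= N), which carry the index
   None below. *)
Definition iid_innovations {d q : nat} (N : nat)
    (Urn : nat -> nat -> Omega -> 'rV[R]_q)
    (innov : nat -> nat -> nat -> Omega -> 'rV[R]_q)
    (theta0 : nat -> Omega -> 'rV[R]_d) : Prop :=
  forall n, (0 < n)%N ->
  [/\ forall p, (0 < p)%N -> random_element (pack N (innov n p)),
      forall p, (0 < p)%N ->
        same_law (pack N (innov n p)) (pack N (fun r => Urn r n)) &
      mutually_independent (fun o : option nat =>
        if o is Some p then sigma_of (pack N (innov n p.+1))
        else sigma_of (pack N (fun r => theta0 (r * n)%N)))].

End Probability.

Section Assumptions.
Context {R : realType} {disp : measure_display} {Omega : measurableType disp}.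
Variable P : probability Omega R.
Context {d q : nat}.
Local Notation V := ('rV[R]_d).
Local Notation W := ('rV[R]_q).

Definition HR (alpha : R) (N : nat) (h : V -> V) (hn : nat -> V -> V)
    (thetas : V) : Prop :=
  (exists Lambda : forall l : nat, nat -> V -> l.-tuple V -> V,
   [/\ forall theta (e : R), 0 < e -> \forall n \near \oo,
         enorm (h theta - hn n theta -
           \sum_(1 <= j < N.+1)
             (n%:R `^ (- (alpha * j%:R))) *: Lambda 0%N j theta [tuple])
         <= e * n%:R `^ (- (alpha * N%:R)),
       forall l j theta, (0 < l < N)%N -> (0 < j <= N - l)%N ->
         multilinear (Lambda l j theta) &
       forall l theta, (0 < l < N)%N -> forall e : R, 0 < e ->
         \forall n \near \oo,
         mnorm_le (fun v : l.-tuple V => Dn (hn n) theta v - Dn h theta v -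
           \sum_(1 <= j < (N - l).+1)
             (n%:R `^ (- (alpha * j%:R))) *: Lambda l j theta v)
         (e * n%:R `^ (- (alpha * (N - l)%:R)))]) /\
  [/\ class_C N h /\ (forall n, (0 < n)%N -> class_C N (hn n)),
      forall l, (0 < l <= N)%N -> forall theta0 : V,
        exists2 B : set V, nbhs theta0 B &
        forall e : R, 0 < e -> \forall n \near \oo, forall theta, B theta ->
          mnorm_le (fun v : l.-tuple V => Dn (hn n) theta v - Dn h theta v) e &
      jacobian h thetas \in unitmx].

Variable H : V -> W -> V.

Definition HUI (Un : nat -> Omega -> W) : Prop :=
  exists2 delta : R, 0 < delta & forall theta : V,
    (ereal_sup [set 'E_P[fun w => (enorm (H theta (Un n w)) `^ (2 + delta))%R]
                | n in [set n | (0 < n)%N]] < +oo)%E.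

Definition HC1 (Un : nat -> Omega -> W) (thetasn : nat -> V) : Prop :=
  exists2 C : R, 0 < C & forall n (theta : V), (0 < n)%N ->
    ('E_P[fun w => (enorm (H theta (Un n w)) ^+ 2)%R]
     <= (C * (1 + enorm (theta - thetasn n) ^+ 2))%:E)%E.

Definition HC2 (U : Omega -> W) : Prop :=
  forall theta : V,
    P [set w | ~ {for U w, continuous (H theta)}] = 0%E.

Definition HRG (Un : nat -> Omega -> W) : Prop :=
  exists2 a : R, 0 < a <= 1 &
    (ereal_sup [set y : \bar R | exists n (theta theta' : V),
      [/\ (0 < n)%N, theta != theta' &
        y = ('E_P[fun w =>
               (enorm (H theta (Un n w) - H theta' (Un n w)) ^+ 2)%R]
             * ((enorm (theta - theta') `^ (2 * a))^-1)%:E)%E]] < +oo)%E.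

(* jacobian is the transpose of the usual Jacobian matrix. *)
Definition HUA (hn : nat -> V -> V) (lambda : R) : Prop :=
  [/\ 0 < lambda,
      forall n, (0 < n)%N -> class_C 1 (hn n),
      exists L : R, forall n (theta theta' v : V), (0 < n)%N ->
        enorm ('d (hn n) theta v - 'd (hn n) theta' v)
        <= L * enorm (theta - theta') * enorm v &
      (lambda%:E < ereal_inf [set y : \bar R | exists n (theta : V),
         (0 < n)%N /\
         y = (lambda_min (2^-1 *: (jacobian (hn n) theta +
                                   (jacobian (hn n) theta)^T)))%:E])%E].

Definition HS (gamma : R -> R) (lambda : R) : Prop :=
  [/\ forall t, 0 <= t -> 0 < gamma t,
      forall s t, 0 <= s -> s <= t -> gamma t <= gamma s,
      gamma t @[t --> +oo] --> 0 &
      (exists2 rho : R, 2^-1 < rho < 1 & forall x : R, 0 < x ->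
         gamma (t * x) / gamma t @[t --> +oo] --> x `^ (- rho)) \/
      (exists2 g0 : R, forall t, 1 <= t -> gamma t = g0 / t &
         1 < 2 * lambda * g0)].

End Assumptions.

Section RichardsonRomberg.
Context {R : realType}.
Variables (alpha : R) (N : nat).

Definition rr_coef (r : nat) : R :=
  (-1) ^+ (N - r) /
  ((\prod_(0 <= j < r) (r%:R `^ alpha - j%:R `^ alpha)) *
   (\prod_(r.+1 <= j < N.+1) (j%:R `^ alpha - r%:R `^ alpha))).

(* The matrix weight is rr_weight r times the identity: it acts by scaling. *)
Definition rr_weight (r : nat) : R := r%:R `^ (alpha * N%:R) * rr_coef r.

Definition rr_weight_next : R := (-1) ^+ N.-1 / (N`!)%:R `^ alpha.

Definition eps_next {d : nat} (eps : nat -> nat -> 'M[R]_d) (n : nat) :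
    'M[R]_d :=
  rr_weight_next^-1 *: \sum_(1 <= r < N.+1) rr_coef r *: eps r n.

(* theta^{*,rn} = theta^* + sum_{p<N} C_p (rn)^{-alpha p}
     + (rn)^{-alpha N} C_N (1 + eps_r(n)), with eps_r(n) -> 0.
   The remainder is a vector of size o(n^{-alpha N}) that need not be collinear
   with C_N, so eps_r(n) is a square matrix; a scalar c is the case c%:M, whose
   operator norm is |c|. *)
Definition zero_expansion {d : nat} (thetas : 'rV[R]_d)
    (thetasn : nat -> 'rV[R]_d) (C : nat -> 'rV[R]_d)
    (eps : nat -> nat -> 'M[R]_d) : Prop :=
  forall r, (0 < r <= N)%N ->
  (forall n, (0 < n)%N ->
     thetasn (r * n)%N = thetas
       + \sum_(1 <= p < N)
           ((r%:R `^ (alpha * p%:R))^-1 * (n%:R `^ (alpha * p%:R))^-1) *: C p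
       + ((r%:R `^ (alpha * N%:R))^-1 * (n%:R `^ (alpha * N%:R))^-1) *:
           (C N *m (1%:M + eps r n))) /\
  opnorm (eps r n) @[n --> \oo] --> 0.

Definition mu_R {d : nat} (CN : 'rV[R]_d) : R := enorm CN / (N`!)%:R `^ alpha.

Definition nu_R {disp : measure_display} {Omega : measurableType disp}
    (P : probability Omega R) {d q : nat}
    (H : 'rV[R]_d -> 'rV[R]_q -> 'rV[R]_d) (thetas : 'rV[R]_d)
    (Ur : nat -> Omega -> 'rV[R]_q) (C : R) : R :=
  C * Num.sqrt (fine 'E_P[fun w =>
    (enorm (\sum_(1 <= r < N.+1) rr_weight r *: H thetas (Ur r w)) ^+ 2)%R]%E).

Definition cost (K : R) (n M : nat) : R :=
  K * M%:R * n%:R * ((N * N.+1)%:R / 2).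

Definition admissible (mu nu : R) (gamma : R -> R) (eps_norm : nat -> R)
    (phi1 phi2 : nat -> R) (e : R) : set (nat * nat) :=
  [set nM | [/\ (0 < nM.1)%N, (0 < nM.2)%N &
    mu * nM.1%:R `^ (- (alpha * N%:R)) * (1 + eps_norm nM.1)
    + nu * Num.sqrt (gamma nM.2%:R) * (1 + phi1 nM.1 + phi2 nM.2) <= e]].

End RichardsonRomberg.

(* f ~ g at 0, for positive arguments. *)
Definition sim0 {R : realType} (f g : R -> R) : Prop :=
  f e / g e @[e --> 0^'+] --> (1 : R).

(* Main.v *)
Require Import Defs.
From HB Require Import structures.
From mathcomp Require Import all_boot all_order all_algebra.
From mathcomp Require Import all_classical all_reals all_analysis.
From mathcomp Require Import ring.
Import Order.TTheory GRing.Theory Num.Theory.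
Import numFieldTopology.Exports numFieldNormedType.Exports.
Local Open Scope classical_set_scope.
Local Open Scope ring_scope.

(** Everything rests on the minimisation of [n * M] under the constraint that
    defines the admissible set, where the corrections [eps_next], [phi1] and
    [phi2] vanish in the limit.

    Write [a = alpha * N], [b = beta / 2] and [c = nu * sqrt gamma0].  The
    constraint is [mu * n^(-a) * (1 + o(1)) + c * M^(-b) * (1 + o(1)) <= e], and
    the cost is a constant multiple of [n * M].  Ignoring the corrections, a
    Lagrange multiplier gives the share [b / (a + b)] of [e] to the first term
    and [a / (a + b)] to the second, that is, the real point

      [n0 = (mu * (1 + a / b) / e)^(1 / a)],
      [M0 = (c * (1 + b / a) / e)^(1 / b)],

    and the announced equivalent of the cost is the constant times [n0 * M0].

    The lower bound holds for every [e], not only asymptotically: the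
    corrections are nonnegative, so a feasible [(n, M)] satisfies the
    uncorrected constraint, which reads [b * u^(-a) + a * v^(-b) <= a + b] with
    [u = n / n0] and [v = M / M0]; as [u^(-a) >= 1 - a * ln u], and similarly
    for [v], this forces [u * v >= 1] (budget_product_ge1, budget_lower_bound).

    For the upper bound and small [e], [n] is [n0] rounded up and [M] is the
    least integer feasible with that [n].  For every [t > 0] the rounding of [(1 + t) * M0] is
    feasible once [e] is small (near_opt_feasible), so [M <= (1 + t) * M0 + 1],
    while the lower bound gives [M >= M0 * (n0 / n)].  Hence [n ~ n0] and
    [M ~ M0] (budget_optimum).  Taking the least [M] avoids a diagonal choice of
    [t] depending on [e], and also turns the exact lower bound into half of the
    equivalent for [M].

    The matrix [eps_next] is a linear combination of the [eps r n], whose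
    operator norms tend to [0]; its own norm does too, because convergence in
    operator norm is entrywise convergence (opnorm_eps_next_cvg0). *)

(** * The operator norm is controlled by the entries *)

Lemma cvg_sum0 {R : realType} {T I : Type} {F : set_system T} {FF : Filter F}
    (r : seq I) (Q : pred I) (f : I -> T -> R) :
  (forall i, Q i -> f i t @[t --> F] --> 0) ->
  \sum_(i <- r | Q i) f i t @[t --> F] --> 0.
Proof.
move=> f0; elim: r => [|i r IHr].
  rewrite (_ : (fun t => _) = cst 0); first exact: cvg_cst.
  by apply/funext => t; rewrite big_nil.
rewrite (_ : (fun t => _) = fun t =>
  if Q i then f i t + \sum_(j <- r | Q j) f j t
  else \sum_(j <- r | Q j) f j t); last by apply/funext => t; rewrite big_cons.
case: (boolP (Q i)) => [/f0 fi0|_]; last exact: IHr.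
by rewrite -[X in _ --> X]addr0; apply: cvgD.
Qed.

Lemma cvgZ0 {R : realType} {T : Type} {F : set_system T} {FF : Filter F}
    (k : R) (f : T -> R) :
  f t @[t --> F] --> 0 -> k * f t @[t --> F] --> 0.
Proof. by move=> /(cvgM (cvg_cst k)); rewrite mulr0; apply. Qed.

Section EuclideanOperatorNorm.
Context {R : realType} {d : nat}.
Implicit Types (x : 'rV[R]_d) (A : 'M[R]_d).

Lemma coord_le_enorm x j : `|x ord0 j| <= enorm x.
Proof.
rewrite /enorm -sqrtr_sqr ler_wsqrtr// (bigD1 j)//= lerDl.
by apply: sumr_ge0 => i _; exact: sqr_ge0.
Qed.

Lemma enorm_le_sum x : enorm x <= \sum_(j < d) `|x ord0 j|.
Proof.
have s0 : 0 <= \sum_(j < d) `|x ord0 j| by apply: sumr_ge0.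
rewrite /enorm -(ger0_norm s0) -sqrtr_sqr ler_wsqrtr// expr2 mulr_suml.
apply: ler_sum => i _; rewrite -normr_id -[X in X <= _]ger0_norm ?sqr_ge0//.
rewrite normrX expr2 normr_id ler_wpM2l// (bigD1 i)//= lerDl.
by apply: sumr_ge0.
Qed.

Lemma enorm_mulmx_le_sum x A :
  enorm x <= 1 -> enorm (x *m A) <= \sum_(i < d) \sum_(j < d) `|A i j|.
Proof.
move=> x1; apply: le_trans (enorm_le_sum _) _.
rewrite exchange_big/=; apply: ler_sum => j _; rewrite mxE.
apply: le_trans (ler_norm_sum _ _ _) _; apply: ler_sum => i _.
by rewrite normrM ler_piMl// (le_trans (coord_le_enorm x i)).
Qed.

Lemma enorm_mulmx_le_opnorm x A :
  enorm x <= 1 -> enorm (x *m A) <= opnorm A.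
Proof.
move=> x1; apply: ub_le_sup; last by exists x.
exists (\sum_(i < d) \sum_(j < d) `|A i j|) => _ [y y1 <-].
exact: enorm_mulmx_le_sum.
Qed.

Lemma opnorm_ge0 A : 0 <= opnorm A.
Proof.
apply: (le_trans (sqrtr_ge0 _)); apply: (enorm_mulmx_le_opnorm 0 A).
by rewrite /enorm big1 ?sqrtr0// => i _; rewrite mxE expr0n.
Qed.

Lemma entry_le_opnorm A i j : `|A i j| <= opnorm A.
Proof.
have -> : A i j = (('e_i : 'rV_d) *m A) ord0 j by rewrite -rowE mxE.
apply: le_trans (coord_le_enorm _ j) _; apply: enorm_mulmx_le_opnorm.
rewrite /enorm (bigD1 i)//= big1 => [|k /negPf ki]; rewrite mxE/=.
  by rewrite eqxx addr0 expr1n sqrtr1.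
by rewrite ki expr0n.
Qed.

Lemma opnorm_le_sum A : opnorm A <= \sum_(i < d) \sum_(j < d) `|A i j|.
Proof.
apply: ge_sup => [|_ [x x1 <-]]; last exact: enorm_mulmx_le_sum.
exists (enorm (0 *m A)), 0 => //=.
by rewrite /enorm big1 ?sqrtr0// => i _; rewrite mxE expr0n.
Qed.

(** Convergence of matrices can therefore be tested entrywise, which makes it
    stable under linear combinations. *)
Lemma opnorm_cvg0P {T : Type} {F : set_system T} {FF : Filter F}
    (A : T -> 'M[R]_d) :
  opnorm (A t) @[t --> F] --> 0 <->
  forall i j, A t i j @[t --> F] --> 0.
Proof.
split=> [A0 i j|A0].
  apply: norm_cvg0; apply: squeeze_cvgr (cvg_cst 0) A0.
  by apply: nearW => t; rewrite normr_ge0 entry_le_opnorm.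
have S0 : \sum_(i < d) \sum_(j < d) `|A t i j| @[t --> F] --> 0.
  apply: cvg_sum0 => i _; apply: cvg_sum0 => j _.
  by rewrite -(normr0 R); exact: cvg_norm.
apply: squeeze_cvgr (cvg_cst 0) S0.
by apply: nearW => t; rewrite opnorm_ge0 opnorm_le_sum.
Qed.

End EuclideanOperatorNorm.

Lemma opnorm_eps_next_cvg0 {R : realType} {d : nat} (alpha : R) (N : nat)
    (eps : nat -> nat -> 'M[R]_d) :
  (forall r, (0 < r <= N)%N -> opnorm (eps r n) @[n --> \oo] --> 0) ->
  opnorm (eps_next alpha N eps n) @[n --> \oo] --> 0.
Proof.
move=> eps0; apply/opnorm_cvg0P => i j.
have entryE n : eps_next alpha N eps n i j = (rr_weight_next alpha N)^-1 *
    \sum_(1 <= r < N.+1 | (1 <= r < N.+1)%N) rr_coef alpha N r * eps r n i j.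
  by rewrite mxE summxE big_nat; under eq_bigr do rewrite mxE.
rewrite (eq_cvg _ _ entryE); apply: cvgZ0; apply: cvg_sum0 => r rN.
apply: cvgZ0.
by move: i j {entryE}; apply/opnorm_cvg0P/eps0.
Qed.

(** * The scale at which a decreasing power reaches a small level *)

Section LevelPoint.
Context {R : realType}.
Implicit Types s k e t x : R.

(** The solution [t] of [k * t `^ (- s) = e]. *)
Definition level_point s k e : R := (k / e) `^ (1 / s).

Lemma level_point_gt0 s k e : 0 < k -> 0 < e -> 0 < level_point s k e.
Proof. by move=> k0 e0; rewrite powR_gt0// divr_gt0. Qed.

(** Measuring [t] in units of its level point turns the coefficient [k] into the
    level [e]. *)
Lemma powRN_rescale s k e t : 0 < s -> 0 < k -> 0 < e -> 0 <= t ->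
  k * t `^ (- s) = e * (t / level_point s k e) `^ (- s).
Proof.
move=> s0 k0 e0 t0; have ke0 : 0 < k / e by rewrite divr_gt0.
have lp0 := level_point_gt0 s _ _ k0 e0.
rewrite powRM ?invr_ge0 ?(ltW lp0)// -powR_inv1 ?(ltW lp0)// -!powRrM.
have -> : 1 / s * (-1 * - s) = 1 by field; rewrite gt_eqF.
by rewrite powRr1 ?ltW//; field; rewrite gt_eqF.
Qed.

Lemma level_pointE s k e : 0 <= k -> 0 < e ->
  level_point s k e = k `^ (1 / s) * e `^ (- (1 / s)).
Proof.
move=> k0 e0; rewrite /level_point powRM ?invr_ge0 ?(ltW e0)//.
by rewrite -[e^-1]powR_inv1 ?(ltW e0)// -powRrM mulN1r.
Qed.

Lemma inv_level_point_cvg0 s k : 0 < s -> 0 < k ->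
  (level_point s k e)^-1 @[e --> 0^'+] --> 0.
Proof.
move=> s0 k0; have s0' : 0 < 1 / s by rewrite divr_gt0.
apply: cvg_trans (cvgZ0 ((k `^ (1 / s))^-1) _ (powR_cvg0 s0')).
 apply: near_eq_cvg; near=> e.
have e0 : 0 < e by near: e; exact: nbhs_right_gt.
by rewrite level_pointE ?ltW// invfM powRN invrK.
Unshelve. all: by end_near. Qed.

(** One more than the integer part: within 1 of [x] when [x >= 0], and always
    positive, as an admissible parameter has to be. *)
Definition ceil_nat x : nat := (Num.truncn x).+1.

Lemma ceil_nat_ge x : x <= (ceil_nat x)%:R.
Proof. exact/ltW/truncnS_gt. Qed.

Lemma ceil_nat_le x : 0 <= x -> (ceil_nat x)%:R <= x + 1.
Proof. by move=> x0; rewrite /ceil_nat -natr1 lerD2r truncn_le. Qed.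

(** Rounding costs at most one unit, which is negligible against a level point
    tending to infinity. *)
Lemma ceil_level_point_cvg s k x : 0 < s -> 0 < k -> 0 < x ->
  (ceil_nat (x * level_point s k e))%:R / level_point s k e
    @[e --> 0^'+] --> x.
Proof.
move=> s0 k0 x0.
have lim1 : x + (level_point s k e)^-1 @[e --> 0^'+] --> x.
  have := cvgD (cvg_cst x) (inv_level_point_cvg0 _ _ s0 k0).
  by rewrite addr0; apply.
apply: squeeze_cvgr (cvg_cst x) lim1; near=> e.
have lp0 : 0 < level_point s k e.
  by apply: level_point_gt0 => //; near: e; exact: nbhs_right_gt.
rewrite ler_pdivlMr// ceil_nat_ge/= ler_pdivrMr// mulrDl mulVf ?gt_eqF//.
by rewrite ceil_nat_le// mulr_ge0// ltW.
Unshelve. all: by end_near. Qed.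

Lemma ceil_level_point_cvgy s k x : 0 < s -> 0 < k -> 0 < x ->
  ceil_nat (x * level_point s k e) @[e --> 0^'+] --> \oo.
Proof.
move=> s0 k0 x0; apply/cvgnyPge => A; near=> e.
have lp0 : 0 < level_point s k e.
  by apply: level_point_gt0 => //; near: e; exact: nbhs_right_gt.
rewrite -(ler_nat R); apply: le_trans (ceil_nat_ge _).
have A0 : 0 < A%:R + 1 :> R by rewrite ltr_wpDl.
have : (level_point s k e)^-1 <= x / (A%:R + 1).
  near: e; apply: cvgr_le (inv_level_point_cvg0 _ _ s0 k0) _ _.
  by rewrite divr_gt0.
rewrite ler_pdivlMr// mulrC ler_pdivrMr// => h.
by apply: le_trans h; rewrite lerDl.
Unshelve. all: by end_near. Qed.

Lemma powR_cvg {T : Type} {F : set_system T} {FF : Filter F}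
    (f : T -> R) x s :
  0 < x -> f t @[t --> F] --> x -> f t `^ s @[t --> F] --> x `^ s.
Proof.
move=> x0 fx.
have cx : {for x, continuous (fun y => y `^ s)}.
  apply: differentiable_continuous; apply/derivable1_diffP/derivable_powR.
  by rewrite in_itv/= x0.
exact: (continuous_cvg _ cx fx).
Qed.

End LevelPoint.

(** * Minimising a product under a sum of two decreasing powers *)

Section BudgetOptimisation.
Context {R : realType}.

(** Each power is bounded below by its tangent in the logarithmic variable at
    the optimum [u = v = 1]; the weights are those for which the two slopes in
    [ln u] and [ln v] agree. *)
Lemma budget_product_ge1 (a b u v : R) : 0 < a -> 0 < b -> 0 < u -> 0 < v ->
  b / (a + b) * u `^ (- a) + a / (a + b) * v `^ (- b) <= 1 -> 1 <= u * v.
Proof.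
move=> a0 b0 u0 v0 le1.
have tangent x s : 0 < x -> 1 - s * ln x <= x `^ (- s).
  by move=> x0; rewrite /powR gt_eqF// -mulNr expR_ge1Dx.
have ab0 : 0 < a + b by rewrite addr_gt0.
have lnD_ge0 : 0 <= ln u + ln v.
  have : b * (1 - a * ln u) + a * (1 - b * ln v) <= a + b.
    apply: le_trans (_ : (a + b) * 1 <= _); last by rewrite mulr1.
    apply: le_trans (ler_wpM2l (ltW ab0) le1).
    rewrite [leRHS](_ : _ = b * u `^ (- a) + a * v `^ (- b)); last first.
      by field; rewrite gt_eqF.
    by rewrite lerD// ler_wpM2l ?tangent// ltW.
  rewrite (_ : b * (1 - a * ln u) + a * (1 - b * ln v)
             = a + b - a * b * (ln u + ln v)); last by ring.
  by rewrite lerBlDr lerDl pmulr_rge0// mulr_gt0.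
rewrite leNgt; apply/negP => uv1.
have uv : 0 < u * v < 1 by rewrite mulr_gt0.
by have := ln_lt0 uv; rewrite lnM ?posrE// ltNge lnD_ge0.
Qed.

Variables (a b mu c : R) (phi0 phi1 phi2 : nat -> R).
Hypotheses (a0 : 0 < a) (b0 : 0 < b) (mu0 : 0 < mu) (c0 : 0 < c).
Hypothesis phi0_ge0 : forall n, (0 < n)%N -> 0 <= phi0 n.
Hypothesis phi1_ge0 : forall n, (0 < n)%N -> 0 <= phi1 n.
Hypothesis phi2_ge0 : forall M, (0 < M)%N -> 0 <= phi2 M.

Definition budget (n M : nat) : R :=
  mu * n%:R `^ (- a) * (1 + phi0 n) + c * M%:R `^ (- b) * (1 + phi1 n + phi2 M).

Definition opt_fst : R -> R := level_point a (mu * (1 + a / b)).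
Definition opt_snd : R -> R := level_point b (c * (1 + b / a)).

Let ka_gt0 : 0 < mu * (1 + a / b).
Proof. by rewrite mulr_gt0// addr_gt0// divr_gt0. Qed.

Let kb_gt0 : 0 < c * (1 + b / a).
Proof. by rewrite mulr_gt0// addr_gt0// divr_gt0. Qed.

Lemma opt_fst_gt0 e : 0 < e -> 0 < opt_fst e.
Proof. exact: level_point_gt0. Qed.

Lemma opt_snd_gt0 e : 0 < e -> 0 < opt_snd e.
Proof. exact: level_point_gt0. Qed.

(** In units of the optimal point, the budget is [e] times a function that does
    not involve [mu] and [c]. *)
Lemma budget_rescale n M e : 0 < e ->
  budget n M = e * (b / (a + b) * (n%:R / opt_fst e) `^ (- a) * (1 + phi0 n)
    + a / (a + b) * (M%:R / opt_snd e) `^ (- b) * (1 + phi1 n + phi2 M)).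
Proof.
move=> e0; rewrite /budget.
have ab0 : a + b != 0 by rewrite gt_eqF// addr_gt0.
have -> : mu * n%:R `^ (- a) =
    b / (a + b) * (mu * (1 + a / b) * n%:R `^ (- a)).
  by field; rewrite gt_eqF.
have -> : c * M%:R `^ (- b) =
    a / (a + b) * (c * (1 + b / a) * M%:R `^ (- b)).
  by field; rewrite gt_eqF.
rewrite (powRN_rescale a (mu * (1 + a / b)) e)//.
rewrite (powRN_rescale b (c * (1 + b / a)) e)//.
rewrite -/(opt_fst e) -/(opt_snd e).
move: (_ `^ (- a)) (_ `^ (- b)) => x y.
by ring.
Qed.

(** The corrections only tighten the constraint, so that no asymptotics enter
    here. *)
Lemma budget_lower_bound n M e : (0 < n)%N -> (0 < M)%N -> 0 < e ->
  budget n M <= e -> opt_fst e * opt_snd e <= n%:R * M%:R.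
Proof.
move=> n0 M0 e0; rewrite (budget_rescale _ _ e)// -[leRHS]mulr1.
rewrite ler_pM2l// => le1.
have pf := opt_fst_gt0 _ e0; have ps := opt_snd_gt0 _ e0.
have ab0 : 0 < a + b by rewrite addr_gt0.
have : 1 <= n%:R / opt_fst e * (M%:R / opt_snd e).
  apply: (budget_product_ge1 _ _ _ _ a0 b0); rewrite ?divr_gt0 ?ltr0n//.
  apply: le_trans le1; rewrite -!addrA.
  apply: lerD; rewrite ler_peMr ?lerDl ?addr_ge0 ?phi0_ge0 ?phi1_ge0 ?phi2_ge0//;
    by rewrite mulr_ge0 ?powR_ge0// divr_ge0// ltW.
rewrite mulf_div ler_pdivlMr ?mulr_gt0//.
by rewrite mul1r.
Qed.

Hypothesis phi0_cvg : phi0 n @[n --> \oo] --> 0.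
Hypothesis phi1_cvg : phi1 n @[n --> \oo] --> 0.
Hypothesis phi2_cvg : phi2 n @[n --> \oo] --> 0.

(* The factor 1 gives both coordinates the form x * level_point s k e. *)
Let fst_nat e := ceil_nat (1 * opt_fst e).

(** The optimal point spends the whole budget, so that a slack in the second
    variable leaves room for the vanishing corrections and for rounding. *)
Lemma near_opt_feasible t : 0 < t ->
  \forall e \near 0^'+, budget (fst_nat e) (ceil_nat ((1 + t) * opt_snd e)) <= e.
Proof.
move=> t0; have t1 : 0 < 1 + t by rewrite addr_gt0.
set M := fun e => ceil_nat ((1 + t) * opt_snd e).
have ab0 : 0 < a + b by rewrite addr_gt0.
have fst_oo : fst_nat e @[e --> 0^'+] --> \oo by exact: ceil_level_point_cvgy.
have M_oo : M e @[e --> 0^'+] --> \oo by exact: ceil_level_point_cvgy.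
have u1 : ((fst_nat e)%:R / opt_fst e) `^ (- a) @[e --> 0^'+] --> 1 `^ (- a).
  by apply: powR_cvg => //; exact: ceil_level_point_cvg.
have v1 : ((M e)%:R / opt_snd e) `^ (- b) @[e --> 0^'+] --> (1 + t) `^ (- b).
  by apply: powR_cvg => //; exact: ceil_level_point_cvg.
have p0 : phi0 (fst_nat e) @[e --> 0^'+] --> 0 by exact: cvg_comp fst_oo phi0_cvg.
have p1 : phi1 (fst_nat e) @[e --> 0^'+] --> 0 by exact: cvg_comp fst_oo phi1_cvg.
have p2 : phi2 (M e) @[e --> 0^'+] --> 0 by exact: cvg_comp M_oo phi2_cvg.
have lim : b / (a + b) * ((fst_nat e)%:R / opt_fst e) `^ (- a)
      * (1 + phi0 (fst_nat e))
    + a / (a + b) * ((M e)%:R / opt_snd e) `^ (- b)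
      * (1 + phi1 (fst_nat e) + phi2 (M e)) @[e --> 0^'+] -->
    b / (a + b) * 1 `^ (- a) * (1 + 0)
    + a / (a + b) * (1 + t) `^ (- b) * (1 + 0 + 0).
  apply: cvgD; apply: cvgM.
  - by apply: cvgM u1; exact: cvg_cst.
  - by apply: cvgD p0; exact: cvg_cst.
  - by apply: cvgM v1; exact: cvg_cst.
  - by apply: cvgD p2; apply: cvgD p1; exact: cvg_cst.
have lt1 : b / (a + b) * 1 `^ (- a) * (1 + 0)
    + a / (a + b) * (1 + t) `^ (- b) * (1 + 0 + 0) < 1.
  rewrite !addr0 powR1 !mulr1.
  rewrite [ltRHS](_ : 1 = b / (a + b) + a / (a + b) * 1); last first.
    by field; rewrite gt_eqF.
  rewrite ltrD2l ltr_pM2l ?divr_gt0// powRN invf_lt1 ?powR_gt0//.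
  rewrite [ltLHS](_ : 1 = 1 `^ b); last by rewrite powR1.
  by rewrite gt0_ltr_powR ?nnegrE ?ltW// ltrDl.
near=> e; have e0 : 0 < e by near: e; exact: nbhs_right_gt.
rewrite (budget_rescale _ _ e)// -[leRHS]mulr1 ler_pM2l//.
by near: e; exact: cvgr_le lim _ lt1.
Unshelve. all: by end_near. Qed.

Let feasible e (nM : nat * nat) :=
  [/\ (0 < nM.1)%N, (0 < nM.2)%N & budget nM.1 nM.2 <= e].

(** The feasible set grows with [e], so that large [e] reduce to small ones. *)
Lemma feasible_exists e : 0 < e -> exists nM, feasible e nM.
Proof.
move=> e0; have : \forall e' \near (0 : R)^'+, exists nM, feasible e nM.
  near=> e'; exists (fst_nat e', ceil_nat ((1 + 1) * opt_snd e')); split => //=.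
  apply: (@le_trans _ _ e').
    by near: e'; exact: near_opt_feasible.
  by near: e'; exact: nbhs_right_le.
by move=> /filter_ex[].
Unshelve. all: by end_near. Qed.

(** For small [e], the first coordinate is the optimal one rounded up and the
    second one is the least that is feasible with it.  The lower bound on products then bounds the second
    coordinate from below, and near-optimal feasible points bound it from
    above. *)
Lemma budget_optimum : exists nM : R -> nat * nat,
  [/\ forall e, 0 < e -> feasible e (nM e),
      (nM e).1%:R / opt_fst e @[e --> 0^'+] --> (1 : R) &
      (nM e).2%:R / opt_snd e @[e --> 0^'+] --> (1 : R)].
Proof.
have select (e : R) : exists nM, 0 < e -> feasible e nM /\
    forall M, feasible e (fst_nat e, M) -> nM.1 = fst_nat e /\ (nM.2 <= M)%N.
  have [[M FM]|noM] := pselect (exists M, feasible e (fst_nat e, M)); last first.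
    (* any feasible pair will do, since this happens only for large e *)
    have [e0|e0] := ltP 0 e; last by exists (0, 0)%N.
    have [nM FnM] := feasible_exists _ e0; exists nM => _; split => // M FM.
    by exfalso; apply: noM; exists M.
  have exM : exists M, (fun M => `[< feasible e (fst_nat e, M) >]) M.
    by exists M; apply/asboolP.
  exists (fst_nat e, ex_minn exM) => _.
  case: ex_minnP => m /asboolP Fm minm; split => // M' FM'; split => //=.
  exact/minm/asboolP.
have [nM nMP] := choice select.
exists nM; split; first by move=> e /nMP[].
- have := ceil_level_point_cvg _ _ _ a0 ka_gt0 ltr01.
  apply: cvg_trans; apply: near_eq_cvg; near=> e.
  have e0 : 0 < e by near: e; exact: nbhs_right_gt.
  have F : feasible e (fst_nat e, ceil_nat ((1 + 1) * opt_snd e)).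
    by split => //=; near: e; exact: near_opt_feasible.
  by have [-> _] := (nMP _ e0).2 _ F.
- have inv1 : (((fst_nat e)%:R / opt_fst e)^-1) @[e --> 0^'+] --> (1 : R)^-1.
    by apply: cvgV; [exact: oner_neq0|exact: ceil_level_point_cvg].
  apply/cvgrPdist_le => t t0; have t20 : 0 < t / 2 by rewrite divr_gt0.
  near=> e.
  have e0 : 0 < e by near: e; exact: nbhs_right_gt.
  have pf := opt_fst_gt0 _ e0; have ps := opt_snd_gt0 _ e0.
  have F : feasible e (fst_nat e, ceil_nat ((1 + t / 2) * opt_snd e)).
    by split => //=; near: e; exact: near_opt_feasible.
  have [n1 leM] := (nMP _ e0).2 _ F.
  have [nM1 nM2 nMle] := (nMP _ e0).1.
  rewrite ler_distlC; apply/andP; split.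
  + (* [M / M0 >= n0 / n] *)
    apply: le_trans (_ : ((fst_nat e)%:R / opt_fst e)^-1 <= _).
      near: e; apply: cvgr_ge inv1 _ _.
      by rewrite invr1 ltrBlDr ltrDl.
    have := budget_lower_bound _ _ _ nM1 nM2 e0 nMle; rewrite n1 => lb.
    rewrite invf_div ler_pdivrMr ?ltr0n// mulrAC ler_pdivlMr//.
    by rewrite [leRHS]mulrC.
  + (* [M / M0 <= 1 + t / 2 + 1 / M0], and the last term is at most [t / 2] *)
    rewrite ler_pdivrMr//.
    apply: le_trans (_ : (ceil_nat ((1 + t / 2) * opt_snd e))%:R <= _).
      by rewrite ler_nat.
    apply: le_trans (ceil_nat_le _ _) _.
      by rewrite mulr_ge0 ?ltW// addr_gt0.
    rewrite -lerBrDl -mulrBl -ler_pdivrMr// mul1r.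
    rewrite (_ : 1 + t - (1 + t / 2) = t / 2); last by field.
    near: e; exact: cvgr_le (inv_level_point_cvg0 _ _ b0 kb_gt0) _ t20.
Unshelve. all: by end_near. Qed.

End BudgetOptimisation.

(** * Asymptotically optimal parameters *)

Lemma sim0_nearE {R : realType} (f g f' g' : R -> R) :
  (forall e, 0 < e -> f e / g e = f' e / g' e) -> sim0 f' g' -> sim0 f g.
Proof.
move=> fg; apply: cvg_trans; apply: near_eq_cvg; near=> e.
by rewrite fg//; near: e; exact: nbhs_right_gt.
Unshelve. all: by end_near. Qed.

Lemma sqrt_power_step {R : realType} (gamma0 beta : R) (M : nat) :
  0 <= gamma0 ->
  Num.sqrt (gamma0 / M%:R `^ beta) = Num.sqrt gamma0 * M%:R `^ (- (beta / 2)).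
Proof.
move=> g0; rewrite sqrtrM// sqrtrV ?powR_ge0//.
by rewrite -(powR12_sqrt (powR_ge0 _ _)) -powRrM powRN.
Qed.

Theorem proposition2p4
  (R : realType) (disp : measure_display) (Omega : measurableType disp)
  (P : probability Omega R) (d q N : nat) (alpha : R)
  (H : 'rV[R]_d -> 'rV[R]_q -> 'rV[R]_d)
  (U : Omega -> 'rV[R]_q) (Un : nat -> Omega -> 'rV[R]_q)
  (Urn : nat -> nat -> Omega -> 'rV[R]_q) (Ur : nat -> Omega -> 'rV[R]_q)
  (thetas : 'rV[R]_d) (thetasn : nat -> 'rV[R]_d)
  (theta0n : nat -> Omega -> 'rV[R]_d) (theta0 : Omega -> 'rV[R]_d)
  (innov : nat -> nat -> nat -> Omega -> 'rV[R]_q)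
  (gamma : R -> R) (lambda gamma0 beta K : R)
  (C : nat -> 'rV[R]_d) (eps : nat -> nat -> 'M[R]_d)
  (Cst : R) (phi1 phi2 : nat -> R)
  (N_gt0 : (0 < N)%N) (alpha_gt0 : 0 < alpha) (K_gt0 : 0 < K)
  (mH : borel_fun (fun x : 'rV[R]_d * 'rV[R]_q => H x.1 x.2))
  (mU : random_element U)
  (mUn : forall n, (0 < n)%N -> random_element (Un n))
  (mUrn : forall r n, (0 < r <= N)%N -> (0 < n)%N -> random_element (Urn r n))
  (mUr : forall r, (0 < r <= N)%N -> random_element (Ur r))
  (mtheta0n : forall n, (0 < n)%N -> random_element (theta0n n))
  (mtheta0 : random_element theta0)
  (law_Urn : forall r n, (0 < r <= N)%N -> (0 < n)%N ->
     same_law P (Urn r n) (Un (r * n)%N))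
  (law_Ur : forall r, (0 < r <= N)%N -> same_law P (Ur r) U)
  (thetasP : forall theta, mean_field P H U theta = 0 <-> theta = thetas)
  (thetasnP : forall n, (0 < n)%N ->
     forall theta, mean_field P H (Un n) theta = 0 <-> theta = thetasn n)
  (iid_innov : iid_innovations P N Urn innov theta0n)
  (theta0n_L2 : (ereal_sup [set 'E_P[fun w => (enorm (theta0n n w) ^+ 2)%R]
                            | n in [set n | (0 < n)%N]] < +oo)%E)
  (gamma_sum : series (fun p : nat => gamma p.+1%:R) @ \oo --> +oo)
  (gamma_sum2 : cvgn (series (fun p : nat => gamma p.+1%:R ^+ 2)))
  (cvg_Urn : forall r, (0 < r <= N)%N ->
     cvg_in_proba P (fun n => Urn r n) (Ur r))
  (cvg_theta0 : cvg_in_proba P theta0n theta0)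
  (hHR : HR alpha N (mean_field P H U) (fun n => mean_field P H (Un n)) thetas)
  (hHUI : HUI P H Un)
  (hHC1 : HC1 P H Un thetasn)
  (hHC2 : HC2 P H U)
  (hHRG : HRG P H Un)
  (hHUA : HUA (fun n => mean_field P H (Un n)) lambda)
  (hHS : HS gamma lambda)
  (gamma0_gt0 : 0 < gamma0) (beta_itv : 2^-1 < beta <= 1)
  (gammaE : forall p, (0 < p)%N -> gamma p%:R = gamma0 / p%:R `^ beta)
  (C_expansion : zero_expansion alpha N thetas thetasn C eps)
  (Cst_gt0 : 0 < Cst)
  (phi1_gt0 : forall n, (0 < n)%N -> 0 < phi1 n)
  (phi2_gt0 : forall M, (0 < M)%N -> 0 < phi2 M)
  (phi1_cvg : phi1 n @[n --> \oo] --> 0)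
  (phi2_cvg : phi2 M @[M --> \oo] --> 0)
  (phi2_noninc : forall M M', (0 < M)%N -> (M <= M')%N -> phi2 M' <= phi2 M)
  (stat_error : forall n M, (0 < n)%N -> (0 < M)%N ->
     ('E_P[fun w => enorm (\sum_(1 <= r < N.+1) rr_weight alpha N r *:
         (thetasn (r * n)%N
          - sa_scheme H gamma (theta0n (r * n)%N) (fun p => innov n p r) M w))]
      <= (nu_R alpha N P H thetas Ur Cst * Num.sqrt (gamma M%:R)
          * (1 + phi1 n + phi2 M))%:E)%E)
  (* otherwise the claimed equivalent is 0 and f/g -> 1 has no meaning *)
  (mu_gt0 : 0 < mu_R alpha N (C N))
  (nu_gt0 : 0 < nu_R alpha N P H thetas Ur Cst) :
  let mu := mu_R alpha N (C N) in
  let nu := nu_R alpha N P H thetas Ur Cst in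
  let aN := alpha * N%:R in
  let A := admissible alpha N mu nu gamma
             (fun n => opnorm (eps_next alpha N eps n)) phi1 phi2 in
  let bound (e : R) :=
    K * ((N * N.+1)%:R / 2) * gamma0 `^ (1 / beta) * nu `^ (2 / beta)
    * mu `^ (1 / aN) * (1 / e `^ (2 / beta + 1 / aN))
    * (1 + 2 * aN / beta) `^ (1 / aN) * (1 + beta / (2 * aN)) `^ (2 / beta) in
  sim0 (fun e => inf [set cost N K nM.1 nM.2 | nM in A e]) bound /\
  exists n M : R -> nat,
  [/\ forall e, 0 < e -> A e (n e, M e),
      sim0 (fun e => cost N K (n e) (M e)) bound,
      sim0 (fun e => (n e)%:R)
           (fun e => (2 * aN / beta + 1) `^ (1 / aN) * mu `^ (1 / aN)
                     * e `^ (- (1 / aN))) &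
      sim0 (fun e => (M e)%:R)
           (fun e => gamma0 `^ (1 / beta) * nu `^ (2 / beta)
                     * (1 + beta / (2 * aN)) `^ (2 / beta)
                     * e `^ (- (2 / beta)))].
Proof.
move=> mu nu aN A bound.
have aN0 : 0 < aN by rewrite mulr_gt0// ltr0n.
have beta0 : 0 < beta.
  by case/andP: beta_itv => + _; apply: lt_trans; rewrite invr_gt0.
pose b := beta / 2; have b0 : 0 < b by rewrite divr_gt0.
pose c := nu * Num.sqrt gamma0; have c0 : 0 < c by rewrite mulr_gt0// sqrtr_gt0.
pose phi0 n := opnorm (eps_next alpha N eps n).
have phi0_cvg : phi0 n @[n --> \oo] --> 0.
  by apply: opnorm_eps_next_cvg0 => r rN; exact: (C_expansion r rN).2.
have phi0_ge0 n : (0 < n)%N -> 0 <= phi0 n by move=> _; exact: opnorm_ge0.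
have phi1_ge0 n : (0 < n)%N -> 0 <= phi1 n by move=> /phi1_gt0/ltW.
have phi2_ge0 M : (0 < M)%N -> 0 <= phi2 M by move=> /phi2_gt0/ltW.
have AE e nM : A e nM <-> [/\ (0 < nM.1)%N, (0 < nM.2)%N &
    budget aN b mu c phi0 phi1 phi2 nM.1 nM.2 <= e].
  have statE : (0 < nM.2)%N ->
      c * nM.2%:R `^ (- b) = nu * Num.sqrt (gamma nM.2%:R).
    by move=> M0; rewrite gammaE// sqrt_power_step ?ltW// mulrA.
  by split=> -[n0 M0 le]; split=> //; move: le; rewrite /budget statE.
have fstE e : 0 < e -> opt_fst aN b mu e =
    (2 * aN / beta + 1) `^ (1 / aN) * mu `^ (1 / aN) * e `^ (- (1 / aN)).
  move=> e0; rewrite /opt_fst level_pointE//; last first.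
    by rewrite ltW// mulr_gt0// addr_gt0// divr_gt0.
  rewrite powRM ?(ltW mu_gt0)//; last by rewrite addr_ge0// divr_ge0// ltW.
  rewrite [mu `^ _ * _]mulrC (_ : 1 + aN / b = 2 * aN / beta + 1)//.
  by rewrite /b; field; rewrite gt_eqF.
have invbE : 1 / b = 2 / beta by rewrite /b; field; rewrite gt_eqF.
have sndE e : 0 < e -> opt_snd aN b c e =
    gamma0 `^ (1 / beta) * nu `^ (2 / beta)
    * (1 + beta / (2 * aN)) `^ (2 / beta) * e `^ (- (2 / beta)).
  move=> e0; rewrite /opt_snd level_pointE//; last first.
    by rewrite ltW// mulr_gt0// addr_gt0// divr_gt0.
  rewrite invbE powRM ?(ltW c0)//; last by rewrite addr_ge0// divr_ge0// ltW.
  rewrite /c powRM ?sqrtr_ge0 ?(ltW nu_gt0)// -powR12_sqrt ?ltW// -powRrM.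
  rewrite (_ : 2^-1 * (2 / beta) = 1 / beta); last by field; rewrite gt_eqF.
  rewrite [nu `^ _ * _]mulrC (_ : b / aN = beta / (2 * aN))//.
  by rewrite /b; field; rewrite gt_eqF.
have boundE e : 0 < e -> bound e =
    K * ((N * N.+1)%:R / 2) * (opt_fst aN b mu e * opt_snd aN b c e).
  move=> e0; rewrite fstE// sndE// /bound [1 + 2 * aN / beta]addrC
    [1 / e `^ _]div1r -powRN.
  rewrite opprD powRD; last by rewrite (gt_eqF e0) implybT.
  move: (_ `^ (1 / beta)) (nu `^ _) (mu `^ _) (e `^ _) (e `^ _) => x1 x2 x3 x4 x5.
  by move: (_ `^ _) (_ `^ _) => x6 x7; ring.
have KN0 : 0 < K * ((N * N.+1)%:R / 2).
  by rewrite mulr_gt0// divr_gt0// ltr0n muln_gt0 N_gt0.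
have [nM [nMP fst_sim snd_sim]] := budget_optimum aN b mu c phi0 phi1 phi2
  aN0 b0 mu_gt0 c0 phi0_ge0 phi1_ge0 phi2_ge0 phi0_cvg phi1_cvg phi2_cvg.
have fst0 e : 0 < e -> 0 < opt_fst aN b mu e by exact: opt_fst_gt0.
have snd0 e : 0 < e -> 0 < opt_snd aN b c e by exact: opt_snd_gt0.
have cost_sim : sim0 (fun e => cost N K (nM e).1 (nM e).2) bound.
  have prod_sim : (nM e).1%:R / opt_fst aN b mu e
      * ((nM e).2%:R / opt_snd aN b c e) @[e --> 0^'+] --> (1 : R).
    by rewrite -[X in _ --> X]mulr1; exact: cvgM.
  apply: cvg_trans prod_sim.
  apply: near_eq_cvg; near=> e.
  have e0 : 0 < e by near: e; exact: nbhs_right_gt.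
  rewrite boundE// /cost; field.
  by rewrite !gt_eqF ?fst0 ?snd0// ltr0n.
have bound_le e n M : 0 < e -> A e (n, M) -> bound e <= cost N K n M.
  move=> e0 /AE[n0 M0 le]; rewrite boundE// /cost.
  have -> : K * M%:R * n%:R * ((N * N.+1)%:R / 2)
      = K * ((N * N.+1)%:R / 2) * (n%:R * M%:R) by ring.
  rewrite ler_pM2l//.
  exact: (budget_lower_bound _ _ _ _ phi0 phi1 phi2).
split.
  apply: (squeeze_cvgr _ (cvg_cst (1 : R)) cost_sim); near=> e.
  have e0 : 0 < e by near: e; exact: nbhs_right_gt.
  have AnM : A e (nM e) by apply/AE/nMP.
  have lb : lbound [set cost N K nM.1 nM.2 | nM in A e] (bound e).
    by move=> _ [[n M] /= AenM <-]; exact: bound_le.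
  have bound0 : 0 < bound e by rewrite boundE// mulr_gt0// mulr_gt0 ?fst0 ?snd0.
  rewrite ler_pdivlMr// mul1r ler_pM2r ?invr_gt0//; apply/andP; split.
    by apply: lb_le_inf lb; exists (cost N K (nM e).1 (nM e).2), (nM e).
  by apply: ge_inf; [exists (bound e)|exists (nM e)].
exists (fun e => (nM e).1), (fun e => (nM e).2); split=> //.
- by move=> e e0; rewrite -surjective_pairing; apply/AE/nMP.
- by apply: sim0_nearE fst_sim => e e0; rewrite fstE.
- by apply: sim0_nearE snd_sim => e e0; rewrite sndE.
Unshelve. all: by end_near. Qed.
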